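(* Assume $0<\epsilon<1$. Let $\mathcal P_m$, $m\in[M]$, be nonempty ambiguity sets and let $\mathcal P$ be the joint ambiguity set they induce (see context). Define - $\mathcal X_{\mathrm{RO}}=\{\boldsymbol x\in\mathcal X: f_m(\boldsymbol a_m,\boldsymbol x)\le b_m\ \forall\boldsymbol a_m\in\mathcal A_m,\ \forall m\in[M]\}$, - $\mathcal X_{\text{AS-DRO}}=\{\boldsymbol x\in\mathcal X:\mathbb P_m\{f_m(\boldsymbol a_m,\boldsymbol x)\le b_m\}=1\ \forall\mathbb P_m\in\mathcal P_m,\ \forall m\in[M]\}$, - $\mathcal X_{\mathrm{DRCCP\text{-}J}}=\Bigl\{\boldsymbol x\in\mathcal X:\inf_{\mathbb P\in\mathcal P}\mathbb P\Bigl(\bigcap_{m\in[M]}\{f_m(\boldsymbol a_m,\boldsymbol x)\le b_m\}\Bigr)\ge1-\epsilon\Bigr\}$, - $\mathcal X_{\mathrm{DRCCP\text{-}I}}=\Bigl\{\boldsymbol x\in\mathcal X:\inf_{\mathbb P_m\in\mathcal P_m}\mathbb P_m\{f_m(\boldsymbol a_m,\boldsymbol x)\le b_m\}\ge1-\epsilon\ \ \forall m\in[M]\Bigr\}$. Then $$\mathcal X_{\mathrm{RO}}\subseteq\mathcal X_{\text{AS-DRO}}\subseteq\mathcal X_{\mathrm{DRCCP\text{-}J}}\subseteq\mathcal X_{\mathrm{DRCCP\text{-}I}}.$$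
   Context: $[M]=\{1,\dots,M\}$, $\mathcal X\subseteq\mathbb R^n$, $b_m\in\mathbb R$. For each $m\in[M]$, $(\mathcal A_m,\mathcal F_m)$ is a measurable space (the sample space of row $m$), $\mathcal P_m$ is a set of probability measures on it, and $f_m:\mathcal A_m\times\mathcal X\to\mathbb R$ is such that $\{\boldsymbol a_m\in\mathcal A_m:f_m(\boldsymbol a_m,\boldsymbol x)\le b_m\}$ is measurable for every $\boldsymbol x\in\mathcal X$. Let $\mathcal A=\prod_{m=1}^M\mathcal A_m$ and $\mathcal F=\bigotimes_{m=1}^M\mathcal F_m$; for a measure $\mathbb P$ on $(\mathcal A,\mathcal F)$, $\mathbb P^m$ denotes its marginal on $(\mathcal A_m,\mathcal F_m)$. The induced joint ambiguity set is $$\mathcal P=\{\mathbb P\text{ nonnegative measure on }(\mathcal A,\mathcal F):\ \mathbb P(\mathcal A)=1,\ \mathbb P^m\in\mathcal P_m\ \forall m\in[M]\}.$$ The common tolerance $\epsilon$ is used for every row (i.e. $\epsilon_m=\epsilon$ for all $m$). *)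

(* Defs.v *)
From HB Require Import structures.
From mathcomp Require Import all_boot all_order all_algebra.
From mathcomp Require Import all_classical all_reals all_analysis.

Import Order.TTheory GRing.Theory Num.Theory.

Local Open Scope classical_set_scope.
Local Open Scope ring_scope.

Section product_space.
Context {M : nat} {d : 'I_M -> measure_display}.
Variable A : forall m, measurableType (d m).

Definition measurable_cylinders : set (set (forall m, A m)) :=
  \bigcup_m preimage_set_system setT (fun a : forall m, A m => a m) measurable.

(* The dependent product carries the product sigma-algebra; MathComp-Analysis
   has it only for pairs and for tuples over a single space. *)
Definition product_space := g_sigma_algebraType measurable_cylinders.

HB.instance Definition _ := Measurable.on product_space.

Definition coord (m : 'I_M) (a : product_space) : A m := a m.

Lemma measurable_coord (m : 'I_M) : measurable_fun setT (coord m).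
Proof.
by move=> _ B mB; apply: sub_sigma_algebra; exists m => //; exists B.
Qed.

HB.instance Definition _ (m : 'I_M) :=
  isMeasurableFun.Build _ _ _ _ (coord m) (measurable_coord m).

End product_space.

Arguments coord {M d A} m a.

Section chance_constraints.
Context {R : realType} {n M : nat} {d : 'I_M -> measure_display}
  {A : forall m, measurableType (d m)}.

Definition marginal (P : probability (product_space A) R) (m : 'I_M) :
  probability (A m) R := distribution P (coord m).

(* Terms of type [probability T R] are functions on all subsets of T, with
   unconstrained values off the sigma-algebra, so "the marginal belongs to
   Pm m" has to be read up to equality on measurable sets. *)
Definition joint_ambiguity (Pm : forall m, set (probability (A m) R)) :
    set (probability (product_space A) R) :=
  [set P | forall m, exists2 Q : probability (A m) R,
     Pm m Q & forall B, measurable B -> marginal P m B = Q B].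

(* f m is a total function on 'rV_n; only its values at points of X are used. *)
Variables (X : set 'rV[R]_n) (f : forall m, A m -> 'rV[R]_n -> R)
  (b : 'I_M -> R).

Definition safe_event (m : 'I_M) (x : 'rV[R]_n) : set (A m) :=
  [set a | f m a x <= b m].

Definition joint_safe_event (x : 'rV[R]_n) : set (product_space A) :=
  \bigcap_m (coord m @^-1` safe_event m x).

Definition X_RO : set 'rV[R]_n :=
  [set x | X x /\ forall m (a : A m), f m a x <= b m].

Variable Pm : forall m, set (probability (A m) R).

Definition X_AS_DRO : set 'rV[R]_n :=
  [set x | X x /\ forall m P, Pm m P -> P (safe_event m x) = 1%E].

Variable eps : R.

Definition X_DRCCP_J : set 'rV[R]_n :=
  [set x | X x /\
    ((1 - eps)%:E <=
      ereal_inf [set P (joint_safe_event x) | P in joint_ambiguity Pm])%E].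

Definition X_DRCCP_I : set 'rV[R]_n :=
  [set x | X x /\ forall m,
    ((1 - eps)%:E <= ereal_inf [set P (safe_event m x) | P in Pm m])%E].

End chance_constraints.

(* Main.v *)
(* The only inclusion with content is the last one: given a row m0 and Q in
   Pm m0, the joint ambiguity set must contain a measure whose m0-th marginal is
   Q, and then the joint safe event has at most the Q-mass of the safe event of
   row m0. That measure is the product of Q with arbitrary elements of the other
   Pm m, obtained from a Dirac mass by resampling the coordinates one at a
   time. *)
From HB Require Import structures.
From Pilot Require Import Defs.
From mathcomp Require Import all_boot all_order all_algebra.
From mathcomp Require Import all_classical all_reals all_analysis.
(* [vector.coord] shadows [Defs.coord]. *)
Import Pilot.Defs.

Import Order.TTheory GRing.Theory Num.Theory.

Local Open Scope classical_set_scope.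
Local Open Scope ring_scope.

Section resampling.
Context {M : nat} {d : 'I_M -> measure_display}.
Variable A : forall m, measurableType (d m).

(** Takes a pair, so that a product measure [P \x Q m] can be pushed forward along it. *)
Definition resample (m : 'I_M) (p : product_space A * A m) : product_space A :=
  dfwith p.1 m p.2.

Lemma coord_resample m p : coord m (resample m p) = p.2.
Proof. exact: dfwithin. Qed.

Lemma coord_resample_neq m j p :
  m != j -> coord j (resample m p) = coord j p.1.
Proof. exact: dfwithout. Qed.

(** It suffices to pull back the generating cylinders, and each coordinate of [resample m] is a
    projection: [snd] at [m], [coord j \o fst] at [j != m]. *)
Lemma measurable_resample m : measurable_fun setT (resample m).
Proof.
refine (@measurability _ _ _ _ setT (resample m) (measurable_cylinders A) _ _) => //.
move=> _ [_ [j _ [B mB <-]] <-]; rewrite !setTI.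
rewrite -[X in measurable X]/((coord j \o resample m) @^-1` B).
have [mj|mj] := eqVneq m j; first subst j.
- rewrite (_ : _ \o _ = snd); last exact/funext/coord_resample.
  by rewrite -[X in measurable X]setTI; exact: measurable_snd.
- rewrite (_ : _ \o _ = coord j \o fst); last first.
    by apply/funext => p; exact: coord_resample_neq.
  rewrite -[X in measurable X]setTI.
  by apply: (measurableT_comp (measurable_coord A j) measurable_fst).
Qed.

HB.instance Definition _ m :=
  isMeasurableFun.Build _ _ _ _ (resample m) (measurable_resample m).

End resampling.

Lemma product_probability_exists (R : realType) (M : nat)
    (d : 'I_M -> measure_display) (A : forall m, measurableType (d m))
    (Q : forall m, probability (A m) R) :
  exists P : probability (product_space A) R,
    forall m B, measurable B -> marginal P m B = Q m B.
Proof.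
(* Only the rows of a list are constrained, which permits induction on the list: drawing coordinate
   [k] afresh from [Q k], independently of the rest, corrects marginal [k] and preserves the
   others. *)
suff [P PQ] : exists P : probability (product_space A) R,
    forall m, m \in enum 'I_M ->
    forall B, measurable B -> marginal P m B = Q m B.
  by exists P => m; apply: PQ; rewrite mem_enum.
elim: (enum 'I_M) => [|k s [P PQ]].
  (* The empty list constrains no marginal, so any probability would do. *)
  by exists (dirac (point : product_space A)).
exists (distribution (P \x Q k)%E (resample A k)) => m mks B mB.
rewrite /marginal /distribution /pushforward /=.
have [km|km] := eqVneq k m; first subst m.
- rewrite (_ : _ @^-1` _ = setT `*` B); last first.
    by apply/seteqP; split => p /=; rewrite coord_resample => // -[].
  rewrite product_measure1E// -[RHS]mul1e; congr (_ * _)%E.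
  exact: probability_setT.
(* The fresh coordinate is unconstrained here, so its factor is 1; as [m != k], row [m] lies in [s]
   and the induction hypothesis applies. *)
- rewrite (_ : _ @^-1` _ = (coord m @^-1` B) `*` setT); last first.
    by apply/seteqP; split => p /=; rewrite coord_resample_neq// => -[].
  rewrite product_measure1E//; last first.
    by rewrite -[X in measurable X]setTI; exact: measurable_coord.
  rewrite -[RHS]mule1; congr (_ * _)%E; last exact: probability_setT.
  by apply: PQ => //; move: mks; rewrite inE eq_sym (negbTE km).
Qed.

(** Each complement is null, and finitely many almost sure properties hold almost surely together
    ([filter_forall]). *)
Lemma probability_bigcap1 (R : realType) (d : measure_display)
    (T : measurableType d) (P : probability T R) (I : finType)
    (S : I -> set T) :
  (forall i, measurable (S i)) -> (forall i, P (S i) = 1%E) ->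
  P (\bigcap_i S i) = 1%E.
Proof.
move=> mS PS.
have mI : measurable (\bigcap_i S i).
  by apply: fin_bigcap_measurable => //; exact: finite_finset.
suff PC0 : P (~` \bigcap_i S i) = 0%E.
  rewrite -[X in P X]setCK probability_setC; last exact: measurableC.
  by rewrite PC0 sube0.
apply: measure_negligible; first exact: measurableC.
suff : {ae P, forall t i, S i t}.
  by apply: negligibleS => t St Sti; apply: St => i _; exact: Sti.
apply: filter_forall => i; apply/(negligibleP P (measurableC (mS i))).
by rewrite -[LHS]/(P (~` S i)) probability_setC// PS subee.
Qed.

Theorem theorem14 (R : realType) (n M : nat)
    (d : 'I_M -> measure_display) (A : forall m : 'I_M, measurableType (d m))
    (X : set 'rV[R]_n)
    (f : forall m : 'I_M, A m -> 'rV[R]_n -> R)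
    (b : 'I_M -> R)
    (Pm : forall m : 'I_M, set (probability (A m) R))
    (eps : R)
    (mf : forall (m : 'I_M) (x : 'rV[R]_n), X x ->
       measurable [set a : A m | f m a x <= b m])
    (Pm_nonempty : forall m : 'I_M, Pm m !=set0)
    (eps_gt0 : 0 < eps) (eps_lt1 : eps < 1) :
  [/\ X_RO X f b `<=` X_AS_DRO X f b Pm,
      X_AS_DRO X f b Pm `<=` X_DRCCP_J X f b Pm eps
    & X_DRCCP_J X f b Pm eps `<=` X_DRCCP_I X f b Pm eps].
Proof.
have mcoord x m : X x -> measurable (coord m @^-1` safe_event f b m x).
  move=> Xx; rewrite -[X in measurable X]setTI.
  by apply: measurable_coord => //; exact: mf.
split=> x [Xx safe_x]; split=> //.
- move=> m P _; rewrite (_ : safe_event f b m x = setT) ?probability_setT//.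
  by apply/seteqP; split=> // a _; exact: safe_x.
- apply: le_ereal_inf_tmp => _ [P PPm <-].
  (* No independence of the rows is used: the joint event has mass exactly 1 under every [P] with
     the given marginals. *)
  rewrite probability_bigcap1//.
  + by rewrite lee_fin gerBl ltW.
  + by move=> m; exact: mcoord.
  + move=> m; have [Q PmQ PQ] := PPm m.
    rewrite -[LHS]/(marginal P m (safe_event f b m x)) PQ; last exact: mf.
    exact: safe_x.
- move=> m; apply: le_ereal_inf_tmp => _ [Q PmQ <-].
  (* The family to be realised as marginals: [Q] in row [m], a chosen element of [Pm j] in every
     other row [j]. *)
  pose Q' := dfwith (fun j => projT1 (cid (Pm_nonempty j))) m Q.
  have PmQ' j : Pm j (Q' j).
    by rewrite /Q'; case: dfwithP => // i _; exact: (projT2 (cid (Pm_nonempty i))).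
  have [P PQ'] := product_probability_exists _ _ _ _ Q'.
  apply: (le_trans safe_x).
  apply: (@le_trans _ _ (P (joint_safe_event f b x))).
    apply: ereal_inf_lbound; exists P => // j.
    by exists (Q' j) => // B; exact: PQ'.
  (* The [m]-th marginal of [P] is [Q], so both masses are taken under [P] and monotonicity
     concludes. *)
  have -> : Q (safe_event f b m x) = P (coord m @^-1` safe_event f b m x).
    rewrite -[RHS]/(marginal P m (safe_event f b m x)) PQ'; last exact: mf.
    by rewrite /Q' dfwithin.
  apply: le_measure; rewrite ?inE.
  + apply: fin_bigcap_measurable => [|j _]; first exact: finite_finset.
    exact: mcoord.
  + exact: mcoord.
  + by move=> a; exact.
Qed.
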